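(* Let $\eta>0$ and let $\theta^\star>0$ be the optimal value of $\theta$ in the problem $$\inf_{\theta>0}\ \inf_{\mathbf a:\,(\theta,\mathbf a)\in\mathcal D}\ \mathcal L(\theta,\mathbf a),$$ i.e. a value of $\theta$, with $(\theta,\mathbf a^\star(\theta))\in\mathcal D$, at which the outer infimum is attained. Then $\theta^\star$ is on the surface of the Kullback–Leibler ball of radius $\eta$, i.e. $$R(\theta^\star)=\eta .$$
   Context: Let $n\ge1$, $\boldsymbol\mu\in\mathbb R^n$, $\Sigma\in\mathbb R^{n\times n}$ symmetric positive definite, $\gamma>0$, and let $\mathbf X\sim N(\boldsymbol\mu,\Sigma)$ under the nominal model, with expectation $\mathbb E$. Let $\mathbf 1\in\mathbb R^n$ be the all-ones vector and $\mathcal A=\{\mathbf a\in\mathbb R^n:\mathbf a^T\mathbf 1=1\}$ the set of portfolios. Mean-variance measure of risk: $V_{\mathbf a}(\mathbf X)=\frac\gamma2\,\mathbf a^T(\mathbf X-\boldsymbol\mu)(\mathbf X-\boldsymbol\mu)^T\mathbf a-\mathbf a^T\mathbf X$. Domain: $\mathcal D=\{(\theta,\mathbf a):\theta>0,\ \mathbf a\in\mathcal A,\ \theta\,\mathbf a^T\Sigma\,\mathbf a<1/\gamma\}$. (The infimum over an empty set is $+\infty$.) Lagrangian at the optimal change of measure: $\mathcal L(\theta,\mathbf a)=\frac1\theta\ln\mathbb E[\exp(\theta V_{\mathbf a}(\mathbf X))]+\frac\eta\theta$. For each $\theta>0$ for which some $(\theta,\mathbf a)\in\mathcal D$ exists,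 $\mathbf a^\star(\theta)$ denotes the (unique) minimiser of $\mathbf a\mapsto\frac1\theta\ln\mathbb E[\exp(\theta V_{\mathbf a}(\mathbf X))]$ over $\{\mathbf a:(\theta,\mathbf a)\in\mathcal D\}$, and $S^\star(\theta)=\mathbf a^\star(\theta)^T\Sigma\,\mathbf a^\star(\theta)$. The relative entropy at the optimal portfolio is $$R(\theta)=\frac\theta2\,S^\star(\theta)\,\Gamma(S^\star(\theta);\theta,\gamma)+\frac12\ln(1-\theta\gamma S^\star(\theta)),\qquad \Gamma(S;\theta,\gamma)=\frac{\gamma(1-\theta\gamma S)+\theta}{(1-\theta\gamma S)^2};$$ equivalently $R(\theta)=\mathbb E[m\ln m]$ with $m=\exp(\theta V_{\mathbf a^\star(\theta)}(\mathbf X))/\mathbb E[\exp(\theta V_{\mathbf a^\star(\theta)}(\mathbf X))]$. *)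

(* Defs.v *)
(* MathComp-Analysis. *)
From HB Require Import structures.
From mathcomp Require Import all_boot all_order all_algebra.
From mathcomp Require Import all_classical all_reals all_analysis.

Set Implicit Arguments.
Unset Strict Implicit.
Unset Printing Implicit Defensive.
Import Order.TTheory GRing.Theory Num.Theory.
Import numFieldNormedType.Exports.
Local Open Scope classical_set_scope.
Local Open Scope ring_scope.

Section LinearAlgebra.
Variables (R : realType) (n : nat).

Definition vdot (a b : 'cV[R]_n) : R := (a^T *m b) 0 0.

Definition qform (Sigma : 'M[R]_n) (a : 'cV[R]_n) : R :=
  (a^T *m Sigma *m a) 0 0.

Definition sym_posdef (Sigma : 'M[R]_n) : Prop :=
  Sigma^T = Sigma /\ forall a : 'cV[R]_n, a != 0 -> 0 < qform Sigma a.

Definition portfolio : set 'cV[R]_n := [set a | vdot a (const_mx 1) = 1].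

(* V_a(x) *)
Definition risk (gamma : R) (mu a x : 'cV[R]_n) : R :=
  gamma / 2 * (a^T *m (x - mu) *m (x - mu)^T *m a) 0 0 - vdot a x.

Definition domain (gamma : R) (Sigma : 'M[R]_n) : set (R * 'cV[R]_n) :=
  [set p | [/\ 0 < p.1, portfolio p.2 & p.1 * qform Sigma p.2 < gamma^-1]].

End LinearAlgebra.

Section Model.
Context d (T : measurableType d) (R : realType) (P : probability T R) (n : nat).
Variable X : 'I_n -> {RV P >-> R}.

Definition rvec (w : T) : 'cV[R]_n := \col_i X i w.

(* X ~ N(mu, Sigma), for Sigma positive definite: every nontrivial linear
   combination of the coordinates is a univariate normal variable.  The second
   parameter of normal_prob is the standard deviation; normal_prob m 0 is not
   the Dirac mass at m, but a != 0 makes the variance positive, and for a = 0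
   there is nothing to require. *)
Definition multivariate_normal (mu : 'cV[R]_n) (Sigma : 'M[R]_n) : Prop :=
  forall a : 'cV[R]_n, a != 0 ->
  forall A : set R, measurable A ->
    P ((fun w => vdot a (rvec w)) @^-1` A) =
    normal_prob (vdot a mu) (Num.sqrt (qform Sigma a)) A.

Variables (gamma : R) (mu : 'cV[R]_n) (Sigma : 'M[R]_n).

(* (1/theta) ln E[exp(theta V_a(X))]; the expectation may be +oo outside of the
   domain, hence the extended logarithm. *)
Definition entropic_risk (theta : R) (a : 'cV[R]_n) : \bar R :=
  ((theta^-1)%:E *
     lne 'E_P[fun w => expR (theta * risk gamma mu a (rvec w))])%E.

Definition lagrangian (eta theta : R) (a : 'cV[R]_n) : \bar R :=
  (entropic_risk theta a + (eta / theta)%:E)%E.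

Definition minimisers (theta : R) : set 'cV[R]_n :=
  [set a | domain gamma Sigma (theta, a) /\
     forall b, domain gamma Sigma (theta, b) ->
       (entropic_risk theta a <= entropic_risk theta b)%E].

(* a*(theta); arbitrary when there is no minimiser, in particular when no
   (theta, a) is in the domain. *)
Definition optimal_portfolio (theta : R) : 'cV[R]_n := get (minimisers theta).

Definition inner_value (eta theta : R) : \bar R :=
  ereal_inf [set lagrangian eta theta a |
              a in [set a | domain gamma Sigma (theta, a)]].

Definition outer_value (eta : R) : \bar R :=
  ereal_inf [set inner_value eta theta | theta in [set theta : R | 0 < theta]].

Definition Gamma_coef (S theta : R) : R :=
  (gamma * (1 - theta * gamma * S) + theta) / (1 - theta * gamma * S) ^+ 2.

(* R(theta): closed form of E[m ln m] for the density
   m = exp(theta V_a(X)) / E[exp(theta V_a(X))] at a = a*(theta). *)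
Definition relative_entropy (theta : R) : R :=
  let S := qform Sigma (optimal_portfolio theta) in
  theta / 2 * S * Gamma_coef S theta + 2^-1 * ln (1 - theta * gamma * S).

End Model.

(* Main.v *)
(* Completing the square in the Gaussian integral gives, for S = a^T Sigma a and
   u = 1 - theta gamma S > 0,
     L(theta, a) = theta^-1 (theta^2 S / (2 u) - theta a^T mu - ln u / 2 + eta).
   If theta0 is optimal with optimal portfolio a0, the pair minimises L jointly,
   so theta0 also minimises the one-variable function L(., a0), with the
   portfolio frozen, on the open interval where it stays in the domain; no
   envelope theorem is needed.  At theta0 the derivative of L(., a0) is
   theta0^-2 (R(theta0) - eta), and it vanishes. *)
Require Import Defs.
From HB Require Import structures.
From mathcomp Require Import all_boot all_order all_algebra.
From mathcomp Require Import all_classical all_reals all_analysis.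
From mathcomp Require Import measurable_realfun ring.
Set Implicit Arguments.
Unset Strict Implicit.
Unset Printing Implicit Defensive.
Import Order.TTheory GRing.Theory Num.Theory.
Local Open Scope classical_set_scope.
Local Open Scope ring_scope.

Lemma optimal_portfolio_set0 (R : realType) (d : measure_display)
    (T : measurableType d) (P : probability T R) (n : nat)
    (X : 'I_n -> {RV P >-> R}) (gamma : R) (mu : 'cV[R]_n) (Sigma : 'M[R]_n)
    (theta : R) :
  minimisers X gamma mu Sigma theta = set0 ->
  optimal_portfolio X gamma mu Sigma theta = 0.
Proof.
move=> min0; rewrite /optimal_portfolio getPN; last by move=> a; rewrite min0.
by apply/matrixP => i j; rewrite !mxE.
Qed.

Lemma portfolio_neq0 (R : realType) (n : nat) (a : 'cV[R]_n) :
  portfolio a -> a != 0.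
Proof.
rewrite /portfolio/= /vdot; case: eqVneq => // ->.
by rewrite trmx0 mul0mx mxE => /esym/eqP; rewrite oner_eq0.
Qed.

(* Without a minimiser, [get] returns 0, which is not a portfolio. *)
Lemma optimal_portfolio_minimiser (R : realType) (d : measure_display)
    (T : measurableType d) (P : probability T R) (n : nat)
    (X : 'I_n -> {RV P >-> R}) (gamma : R) (mu : 'cV[R]_n) (Sigma : 'M[R]_n)
    (theta : R) :
  portfolio (optimal_portfolio X gamma mu Sigma theta) ->
  minimisers X gamma mu Sigma theta (optimal_portfolio X gamma mu Sigma theta).
Proof.
move=> /portfolio_neq0 a0.
have [/optimal_portfolio_set0 a_eq0|/set0P[a mina]] :=
  eqVneq (minimisers X gamma mu Sigma theta) set0.
  by rewrite a_eq0 eqxx in a0.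
exact: (getI mina).
Qed.

(** The Radon-Nikodym derivative of [normal_prob m s] agrees almost everywhere with
    [normal_pdf m s], since both integrate to the probability of every measurable set. *)
Lemma ge0_integral_normal_prob (R : realType) (m s : R) (f : R -> \bar R) :
  measurable_fun setT f -> (forall x, 0 <= f x)%E ->
  (\int[normal_prob m s]_x f x =
   \int[lebesgue_measure]_x (f x * (normal_pdf m s x)%:E))%E.
Proof.
move=> mf f0.
have dom := normal_prob_dominates m s.
rewrite -(Radon_Nikodym_SigmaFinite.change_of_variables dom)//.
have mpdf : measurable_fun setT (fun x => (normal_pdf m s x)%:E).
  by apply/measurable_EFinP; exact: measurable_normal_pdf.
have ing := Radon_Nikodym_SigmaFinite.f_integrable dom.
have mg := measurable_int _ ing.
have g0 := Radon_Nikodym_SigmaFinite.f_ge0 dom.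
apply: ge0_ae_eq_integral => //.
- exact: emeasurable_funM.
- exact: emeasurable_funM.
- by move=> x _; rewrite mule_ge0.
- by move=> x _; rewrite mule_ge0// lee_fin normal_pdf_ge0.
apply: ae_eqe_mul2l; apply: integral_ae_eq => // E _ mE.
by rewrite -Radon_Nikodym_SigmaFinite.f_integral.
Qed.

(* Completing the square turns the tilted density into a multiple of another
   normal density. *)
Lemma normal_pdf_tilt (R : realType) (m S b t x : R) :
  0 < S -> b * S < 1 ->
  let u := 1 - b * S in
  expR (b / 2 * (x - m) ^+ 2 - t * x) * normal_pdf m (Num.sqrt S) x =
  expR (t ^+ 2 * S / (2 * u) - t * m) / Num.sqrt u *
    normal_pdf (m - t * S / u) (Num.sqrt (S / u)) x.
Proof.
move=> S0 bS u.
have u0 : 0 < u by rewrite subr_gt0.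
have Su0 : 0 < S / u by rewrite divr_gt0.
rewrite !normal_pdfE ?gt_eqF ?sqrtr_gt0// /normal_fun /normal_peak.
rewrite !sqr_sqrtr ?ltW//.
(* The ratio of the two normalising constants gives the factor [Num.sqrt u]; the rest is an identity
   between exponents. *)
have -> : Num.sqrt (S * pi *+ 2) =
          Num.sqrt u * Num.sqrt (S / u * pi *+ 2).
  rewrite -sqrtrM ?ltW//; congr Num.sqrt.
  by move: (@pi R) => p; field; rewrite gt_eqF.
rewrite invfM mulrCA -mulrA -expRD -[RHS]mulrA [RHS]mulrCA.
rewrite -!mulrA; congr (_ * _); rewrite [RHS]mulrCA; congr (_ * _).
rewrite -expRD; congr expR; rewrite /u; field.
by rewrite !gt_eqF.
Qed.

(** After tilting, only a constant times a normal density is left, and the density integrates to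
    1. *)
Lemma normal_prob_expR_quadratic (R : realType) (m S b t : R) :
  0 < S -> b * S < 1 ->
  let u := 1 - b * S in
  (\int[normal_prob m (Num.sqrt S)]_x
     (expR (b / 2 * (x - m) ^+ 2 - t * x))%:E =
   (expR (t ^+ 2 * S / (2 * u) - t * m) / Num.sqrt u)%:E)%E.
Proof.
move=> S0 bS u.
have mf : measurable_fun setT
    (fun x : R => expR (b / 2 * (x - m) ^+ 2 - t * x)).
  apply: measurableT_comp => //; apply: measurable_funB.
    apply: measurable_funM => //; apply: measurable_funX.
    exact: measurable_funB.
  exact: measurable_funM.
rewrite ge0_integral_normal_prob; last 2 first.
- exact/measurable_EFinP.
- by move=> x; rewrite lee_fin expR_ge0.
under eq_integral do rewrite -EFinM normal_pdf_tilt// EFinM.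
rewrite integralZl//; last exact: integrable_normal_pdf.
by rewrite integral_normal_pdf mule1.
Qed.

Lemma lnsqrt (R : realType) (x : R) : 0 < x -> ln (Num.sqrt x) = ln x / 2.
Proof.
move=> x0; rewrite -[in RHS](sqr_sqrtr (ltW x0)) lnXn ?sqrtr_gt0//.
by field.
Qed.

Section GaussianRisk.
Variables (R : realType) (d : measure_display) (T : measurableType d).
Variables (P : probability T R) (n : nat) (mu : 'cV[R]_n) (Sigma : 'M[R]_n).
Variables (gamma : R) (X : 'I_n -> {RV P >-> R}).
Hypotheses (hSigma : sym_posdef Sigma) (hX : multivariate_normal X mu Sigma).

(** The quadratic term is the square of the scalar [vdot a (x - mu)], so the risk depends on [x]
    only through [vdot a x]. This reduces the expectation to a one-dimensional integral. *)
Lemma riskE (a x : 'cV[R]_n) :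
  risk gamma mu a x =
  gamma / 2 * (vdot a x - vdot a mu) ^+ 2 - vdot a x.
Proof.
rewrite /risk; congr (_ * _ - _).
have -> : vdot a x - vdot a mu = (a^T *m (x - mu)) 0 0.
  by rewrite mulmxBr [RHS]mxE [X in _ = _ + X]mxE.
rewrite -mulmxA -[(x - mu)^T *m a]trmxK trmx_mul trmxK.
by rewrite [LHS]mxE big_ord1 [X in _ * X]mxE expr2.
Qed.

Lemma measurable_vdot_rvec (a : 'cV[R]_n) :
  measurable_fun setT (fun w => vdot a (rvec X w)).
Proof.
rewrite (_ : (fun w => _) = fun w => \sum_(i < n) a i 0 * X i w); last first.
  by apply/funext => w; rewrite /vdot mxE; apply: eq_bigr => i _; rewrite !mxE.
by apply: measurable_sum => i; apply: measurable_funM.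
Qed.

(** Transfer to the law of [vdot a X], normal with variance [S], and apply the Gaussian integral
    with [b = theta * gamma] and [t = theta]. The condition [0 < u] makes the expectation finite. *)
Lemma entropic_riskE (theta : R) (a : 'cV[R]_n) :
  let S := qform Sigma a in
  let u := 1 - theta * gamma * S in
  a != 0 -> 0 < u ->
  entropic_risk X gamma mu theta a =
  (theta^-1 * (theta ^+ 2 * S / (2 * u) - theta * vdot a mu - ln u / 2))%:E.
Proof.
move=> S u a0 u0; have S0 : 0 < S by case: hSigma => _; exact.
rewrite /entropic_risk unlock.
(* [normal_prob] lives on [measurableTypeR R], which has the same measurable sets
   as [R] but a different display. *)
pose Y0 : T -> measurableTypeR R := fun w => vdot a (rvec X w).
have mY0 : measurable_fun setT Y0.
  by move=> mT A; exact: (measurable_vdot_rvec a mT).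
pose Y : {RV P >-> measurableTypeR R} :=
  @mfun_Sub _ _ T (measurableTypeR R) Y0 (mem_set mY0).
pose f (y : measurableTypeR R) :=
  (expR (theta * gamma / 2 * (y - vdot a mu) ^+ 2 - theta * y))%:E.
have mf : measurable_fun setT f.
  apply/measurable_EFinP/measurableT_comp => //; apply: measurable_funB.
    apply: measurable_funM => //; apply: measurable_funX.
    exact: measurable_funB.
  exact: measurable_funM.
have -> : (\int[P]_w (expR (theta * risk gamma mu a (rvec X w)))%:E =
           \int[distribution P Y]_y f y)%E.
  rewrite ge0_integral_distribution//; last first.
    by move=> y; rewrite lee_fin expR_ge0.
  apply: eq_integral => w _ /=.
  by rewrite /f riskE mulrBr !mulrA.
have -> : (\int[distribution P Y]_y f y =
           \int[normal_prob (vdot a mu) (Num.sqrt S)]_y f y)%E.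
  by apply: eq_measure_integral => A mA _; exact: hX.
rewrite normal_prob_expR_quadratic//; last by rewrite -subr_gt0.
rewrite lne_EFin ?divr_gt0 ?expR_gt0 ?sqrtr_gt0//.
by rewrite ln_div ?posrE ?expR_gt0 ?sqrtr_gt0// expRK lnsqrt.
Qed.

End GaussianRisk.

(** The mean [m] drops out of the derivative, because [t^-1 * (t * m)] is constant in [t]. *)
Lemma is_derive_penalised_risk (R : realType) (c S m eta t : R) :
  0 < t -> 0 < 1 - t * c * S ->
  let u := 1 - t * c * S in
  is_derive t 1
    (fun t => t^-1 * (t ^+ 2 * S / (2 * (1 - t * c * S)) - t * m -
                      ln (1 - t * c * S) / 2) + eta / t)
    (t ^- 2 * (t / 2 * S * ((c * u + t) / u ^+ 2) + 2^-1 * ln u - eta)).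
Proof.
move=> t0 u0 u.
have dlin k : is_derive t 1 (fun t => k * t) k.
  by apply: is_derive_eq; rewrite [LHS]mulr1.
have du : is_derive t 1 (fun t => 1 - t * c * S) (- (c * S)).
  rewrite (_ : (fun t => _) = cst 1 \+ (fun t => - (c * S) * t)); last first.
    by apply/funext => x /=; ring.
  by apply: is_derive_eq; rewrite add0r.
have dV : is_derive t 1 (fun t => t^-1) (- t ^- 2).
  have := @is_deriveV R id t 1 1 (lt0r_neq0 t0) (is_derive_id _ _).
  by move/is_derive_eq; apply; rewrite [LHS]mulr1.
have duV : is_derive t 1 (fun t => (1 - t * c * S)^-1) (c * S / u ^+ 2).
  have := @is_deriveV R (fun t => 1 - t * c * S) _ _ _ (lt0r_neq0 u0) du.
  by move/is_derive_eq; apply; rewrite [LHS]mulNr mulrN opprK mulrC.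
have dln : is_derive t 1 (fun t => ln (1 - t * c * S)) (- (c * S) / u).
  have := @is_derive1_comp R _ _ t _ _ (is_derive1_ln u0) du.
  by move/is_derive_eq; apply; rewrite [LHS]mulrC.
have dQ := is_deriveM (dlin (S / 2)) (is_derive_id t 1).
have dB := is_deriveD (is_deriveB (is_deriveB (is_deriveM dQ duV) (dlin m))
  (is_deriveZ 2^-1 dln)) (is_derive_cst eta t 1).
have dF := is_deriveM dV dB.
set F := (X in is_derive _ _ X _).
(* [F] is put in the shape produced by the derivative rules, with the quadratic term split as
   [(S / 2 * t) * t]. *)
have -> : F = (fun t => t^-1) * ((fun t => S / 2 * t) * id *
    (fun t => (1 - t * c * S)^-1) - (fun t => m * t) -
    2^-1 \*: (fun t => ln (1 - t * c * S)) + cst eta).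
  apply/funext => x; rewrite /F !fctE /= invfM.
  by rewrite -[2^-1 *: _]/(2^-1 * ln (1 - x * c * S)); ring.
apply: (is_derive_eq dF).
rewrite /GRing.scale/= !fctE/= -[2^-1 *: _]/(2^-1 * ln u).
move: (ln u) => l; rewrite /u; field.
by rewrite !gt_eqF.
Qed.

Theorem proposition6 (R : realType) (d : measure_display) (T : measurableType d)
    (P : probability T R) (n : nat) (hn : (1 <= n)%N)
    (mu : 'cV[R]_n) (Sigma : 'M[R]_n) (hSigma : sym_posdef Sigma)
    (gamma : R) (hgamma : 0 < gamma)
    (X : 'I_n -> {RV P >-> R}) (hX : multivariate_normal X mu Sigma)
    (eta : R) (heta : 0 < eta)
    (theta : R) (htheta : 0 < theta)
    (hdom : domain gamma Sigma (theta, optimal_portfolio X gamma mu Sigma theta))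
    (hopt : inner_value X gamma mu Sigma eta theta =
            outer_value X gamma mu Sigma eta) :
  relative_entropy X gamma mu Sigma theta = eta.
Proof.
have [_ /= port _] := hdom.
have [_ amin] := optimal_portfolio_minimiser port.
rewrite /relative_entropy.
(* Generalising freezes the portfolio: [a] no longer varies with [theta]. *)
move: (optimal_portfolio X gamma mu Sigma theta) hdom port amin => a hdom port amin.
have a0 := portfolio_neq0 port; set S := qform Sigma a.
have S0 : 0 < S by case: hSigma => _; exact.
have domE t : 0 < t -> domain gamma Sigma (t, a) <-> t < (gamma * S)^-1.
  move=> t0; rewrite /domain/= -/S invfM -ltr_pdivlMr//.
  by split=> [[]|].
have u0 t : t < (gamma * S)^-1 -> 0 < 1 - t * gamma * S.
  by rewrite -[X in _ < X]mul1r ltr_pdivlMr ?mulr_gt0// mulrA subr_gt0.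
pose L t := t^-1 * (t ^+ 2 * S / (2 * (1 - t * gamma * S)) - t * vdot a mu -
                    ln (1 - t * gamma * S) / 2) + eta / t.
have lagE t : t < (gamma * S)^-1 ->
    lagrangian X gamma mu eta t a = (L t)%:E.
  by move=> /u0 ?; rewrite /lagrangian (entropic_riskE hSigma hX).
(* By minimality of [a], [L theta] is at most the inner value at [theta]. This equals the outer
   value, hence is at most the inner value at [t], and so at most [L t], since [a] is still
   admissible at [t]. *)
have Lmin t : t \in `]0, (gamma * S)^-1[ -> L theta <= L t.
  rewrite in_itv/= => /andP[t0 tS].
  rewrite -lee_fin -!lagE//; last exact/domE.
  apply: (@le_trans _ _ (inner_value X gamma mu Sigma eta theta)).
    by apply: le_ereal_inf_tmp => _ [b /amin ab <-]; exact: leeD2r.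
  rewrite hopt; apply: (@le_trans _ _ (inner_value X gamma mu Sigma eta t)).
    by apply: ereal_inf_lbound; exists t.
  by apply: ereal_inf_lbound; exists a => //; apply/domE.
have dL t : t \in `]0, (gamma * S)^-1[ -> 
    is_derive t 1 L (t ^- 2 *
      (t / 2 * S * Gamma_coef gamma S t + 2^-1 * ln (1 - t * gamma * S) - eta)).
  rewrite in_itv/= => /andP[t0 /u0 ut]; exact: is_derive_penalised_risk.
have theta_in : theta \in `]0, (gamma * S)^-1[.
  by rewrite in_itv/= htheta; exact/domE.
have Lder t (tI : t \in `]0, (gamma * S)^-1[) : derivable L t 1.
  by have := dL t tI => -[].
have I0 : 0 <= (gamma * S)^-1 by rewrite invr_ge0 mulr_ge0 ?ltW.
(* Fermat's rule at an interior minimum. The factor [theta ^- 2] is nonzero, so the bracket in [dL]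
   must vanish. *)
have dL0 := derive1_at_min I0 Lder theta_in Lmin.
have := dL _ theta_in; move/(@derive_val _ _ _ _ _ _ _).
rewrite (@derive_val _ _ _ _ _ _ _ dL0) => /esym/eqP.
by rewrite mulf_eq0 invr_eq0 expf_eq0/= gt_eqF//= subr_eq0 => /eqP.
Qed.
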